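(* For every integer $N$ with $1\le N\le 15$ and $N\ne 14$, there does not exist an antipodal $5$-design with $2N$ rational points for the Hermite measure $e^{-t^2}dt/\sqrt{\pi}$ on $(-\infty,\infty)$.
   Context: An $m$-design with $n$ points for a probability measure $w(t)dt$ on an interval $I$ is a set of $n$ pairwise distinct points $x_1,\dots,x_n\in I$ with $\frac1n\sum_i f(x_i)=\int_I f(t)w(t)dt$ for every real polynomial $f$ of degree at most $m$. It is rational if all $x_i\in\mathbb{Q}$ and antipodal if $\{x_i\}=\{-x_i\}$. *)

(* Defs.v *)
From HB Require Import structures.
From mathcomp Require Import all_boot all_order all_algebra.
From mathcomp Require Import all_classical all_reals all_analysis.
Set Implicit Arguments.
Unset Strict Implicit.
Unset Printing Implicit Defensive.
Import Order.TTheory GRing.Theory Num.Theory.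
Local Open Scope classical_set_scope.
Local Open Scope ring_scope.

(* The quadrature identity is stated in the extended reals, so that it also
   forces the integral on the right to be finite. *)
Definition is_design (R : realType) (I : interval R) (w : R -> R) (m n : nat)
    (x : n.-tuple R) : Prop :=
  [/\ uniq x, {in x, forall a, a \in I} &
      forall f : {poly R}, (size f <= m.+1)%N ->
        (n%:R^-1 * \sum_(a <- x) f.[a])%:E =
        (\int[@lebesgue_measure R]_(t in [set` I]) (f.[t] * w t)%:E)%E].

Definition rational_points (R : realType) (n : nat) (x : n.-tuple R) : Prop :=
  {in x, forall a, exists q : rat, a = ratr q}.

Definition antipodal (R : realType) (n : nat) (x : n.-tuple R) : Prop :=
  x =i [seq - a | a <- x].

Definition hermite_weight (R : realType) (t : R) : R :=
  expR (- t ^+ 2) / Num.sqrt pi.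

(* Main.v *)
(** The moments of the Hermite measure force N positive rationals x_i with
    sum x_i^2 = N/2 and sum x_i^4 = 3N/4. Write x_i = a_i / d with d minimal, so
    that d and the a_i are not all even. If k of the a_i are odd and j are
    congruent to 2 modulo 4, then a^2 = 1 mod 8 for odd a turns the two equations
    into linear congruences modulo powers of 2 in k, j and N, which have no
    solution with k + j <= N when N <= 15 and N <> 14. *)
Require Import Defs.
From mathcomp Require Import all_boot all_order all_algebra.
From mathcomp Require Import all_classical all_reals all_analysis.
From mathcomp Require Import measurable_realfun zify ring lra.
Set Implicit Arguments.
Unset Strict Implicit.
Unset Printing Implicit Defensive.
Import Order.TTheory GRing.Theory Num.Theory.
Import numFieldNormedType.Exports.
Local Open Scope classical_set_scope.
Local Open Scope ring_scope.

(** * 2-adic analysis of integer power sums *)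

Lemma int_parity (a : int) : exists m : int, a = 2 * m \/ a = 2 * m + 1.
Proof. by exists (a %/ 2)%Z; lia. Qed.

Lemma odd_int_sqr (m : int) : exists s : int, (2 * m + 1) ^+ 2 = 1 + 8 * s.
Proof.
have [r [->|->]] := int_parity m.
- by exists (2 * r ^+ 2 + r); ring.
- by exists (2 * r ^+ 2 + 3 * r + 1); ring.
Qed.

(* [k] counts the odd terms and [j] those congruent to 2 modulo 4; the same [S]
   occurs in both sums because a^2 = 1 + 8s gives a^4 = 1 + 16s + 64s^2. *)
Lemma sum_sqr_quart_2adic (s : seq int) :
  exists k j S T B C : int,
    [/\ [/\ 0 <= k, 0 <= j & k + j <= (size s)%:Z],
        k = 0 -> {in s, forall a, exists m, a = 2 * m},
        \sum_(a <- s) a ^+ 2 = k + 8 * S + 4 * (j + 4 * B) &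
        \sum_(a <- s) a ^+ 4 = k + 16 * S + 64 * T + 16 * (j + 16 * C)].
Proof.
elim: s => [|a s [k [j [S [T [B [C [[k0 j0 kj] evs IH2 IH4]]]]]]]].
  by exists 0, 0, 0, 0, 0, 0; split; rewrite ?big_nil.
have ev_cons m : k = 0 -> {in 2 * m :: s, forall a, exists m, a = 2 * m}.
  by move=> /evs es b; rewrite inE => /predU1P[->|/es//]; exists m.
have [m [->|->]] := int_parity a; rewrite !big_cons IH2 IH4.
- have [r [mE|mE]] := int_parity m.
  + exists k, j, S, T, (B + r ^+ 2), (C + r ^+ 4).
    split; [by split => //=; lia | exact: ev_cons | rewrite mE; ring..].
  + have [u uE] := odd_int_sqr r; rewrite -mE in uE.
    have m4 : (2 * m) ^+ 4 = 16 * (1 + 8 * u) ^+ 2 by rewrite -uE; ring.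
    have m2 : (2 * m) ^+ 2 = 4 * (1 + 8 * u) by rewrite -uE; ring.
    (* Here [a = 2 * m] with [m] odd, so [a ^+ 2 = 4 * (1 + 4 * (2 * u))] and [a ^+ 4 = 16 * (1 + 16
       * (u + 4 * u ^+ 2))]. *)
    exists k, (j + 1), S, T, (B + 2 * u), (C + u + 4 * u ^+ 2).
    split; [by split => //=; lia | exact: ev_cons | rewrite ?m2 ?m4; ring..].
- have [u uE] := odd_int_sqr m.
  have m4 : (2 * m + 1) ^+ 4 = (1 + 8 * u) ^+ 2 by rewrite -uE; ring.
  exists (k + 1), j, (S + u), (T + u ^+ 2), B, C.
  by split; [split => //=; lia | lia | rewrite ?uE ?m4; ring..].
Qed.

(** The equations are those of the sums of squares and fourth powers of the numerators over the
    denominator [d]. The cases are [d] odd, [d] divisible by 4 and [d] congruent to 2 modulo 4. In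
    each, the remaining powers are generalised to fresh integers, so that fixing [N] leaves a linear
    problem for [lia]. *)
Lemma no_2adic_solution (N k j S T B C d : int) :
  1 <= N <= 15 -> N <> 14 -> 0 <= k -> 0 <= j -> k + j <= N ->
  (k = 0 -> exists m, d = 2 * m + 1) ->
  2 * (k + 8 * S + 4 * (j + 4 * B)) = N * d ^+ 2 ->
  4 * (k + 16 * S + 64 * T + 16 * (j + 16 * C)) = 3 * N * d ^+ 4 -> False.
Proof.
move=> N15 N14 k0 j0 kj kd.
have {N15 N14} Ncases : N = 1 \/ N = 2 \/ N = 3 \/ N = 4 \/ N = 5 \/ N = 6 \/ N = 7 \/
  N = 8 \/ N = 9 \/ N = 10 \/ N = 11 \/ N = 12 \/ N = 13 \/ N = 15 by lia.
have [e [dE|dE]] := int_parity d; last first.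
  (* For [d] odd, N = 4M is forced, with k congruent to 2M modulo 4 and to 3M modulo 16. Hence 4
     divides M and 16 divides N, which is out of range. *)
  have [E EE] := odd_int_sqr e; rewrite -dE in EE.
  have -> : d ^+ 4 = (d ^+ 2) ^+ 2 by ring.
  have -> : (d ^+ 2) ^+ 2 = 1 + 16 * E + 64 * E ^+ 2 by rewrite EE; ring.
  rewrite EE; move: (E ^+ 2) => F {kd dE EE}.
  move=> h2 h4; move: Ncases.
  by do 13! [case=> [NE|]; first by subst N; lia]; move=> NE; subst N; lia.
have {kd} {}k0 : 0 < k by case: (eqVneq k 0) => [/kd[m]|]; lia.
have [g [eE|eE]] := int_parity e.
  (* For 4 dividing [d], the quartic equation makes k a multiple of 16, against 0 < k <= N <= 15. *)
  have -> : d ^+ 2 = 16 * g ^+ 2 by rewrite dE eE; ring.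
  have -> : d ^+ 4 = 256 * g ^+ 4 by rewrite dE eE; ring.
  move: (g ^+ 2) (g ^+ 4) => E F {dE eE}.
  move=> h2 h4; move: Ncases.
  by do 13! [case=> [NE|]; first by subst N; lia]; move=> NE; subst N; lia.
(* For [d] congruent to 2 modulo 4, k is congruent to 12N modulo 16 and to 2N modulo 4. This leaves
   k = 8 with N = 10 or the excluded 14. For N = 10 both equations then give j congruent to 3 modulo
   4, so k + j >= 11 > N. *)
have [E EE] := odd_int_sqr g; rewrite -eE in EE.
have -> : d ^+ 4 = 16 * (e ^+ 2) ^+ 2 by rewrite dE; ring.
have -> : d ^+ 2 = 4 * e ^+ 2 by rewrite dE; ring.
have -> : (e ^+ 2) ^+ 2 = 1 + 16 * E + 64 * E ^+ 2 by rewrite EE; ring.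
rewrite EE; move: (E ^+ 2) => F {dE eE EE}.
move=> h2 h4; move: Ncases.
by do 13! [case=> [NE|]; first by subst N; lia]; move=> NE; subst N; lia.
Qed.

(** * From rational to integer power sums *)

Lemma common_denominator (s : seq rat) :
  exists d : nat, (0 < d)%N && all (fun q => d%:R * q \is a Num.int) s.
Proof.
exists (\prod_(q <- s) `|denq q|)%N; apply/andP; split.
  by rewrite prodn_gt0 // => q; rewrite absz_gt0 denq_neq0.
apply/allP => q qs; rewrite (big_rem q) //= natrM mulrAC.
rewrite rpredM ?rpred_nat // natr_absz gtr0_norm ?denq_gt0 //.
by rewrite -[q in _ * q]divq_num_den mulrC divfK ?intr_eq0 ?denq_neq0 // intr_int.
Qed.

Lemma no_rational_power_sums (s : seq rat) :
  (1 <= size s <= 15)%N -> size s <> 14%N ->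
  2 * \sum_(q <- s) q ^+ 2 = (size s)%:R ->
  4 * \sum_(q <- s) q ^+ 4 = 3 * (size s)%:R -> False.
Proof.
move=> s15 s14 s2 s4.
have exd := common_denominator s.
case: (ex_minnP exd) => d /andP[d0 /allP ds] dmin.
pose a := [seq Num.floor (d%:R * q) | q <- s].
(* The floor loses nothing: [d%:R * q] is already an integer. *)
have aE q : q \in s -> (Num.floor (d%:R * q))%:~R = d%:R * q.
  by move=> qs; apply/eqP; rewrite -intrEfloor; exact: ds.
have sumE n : (\sum_(b <- a) b ^+ n)%:~R = d%:R ^+ n * \sum_(q <- s) q ^+ n :> rat.
  rewrite big_map rmorph_sum mulr_sumr big_seq [RHS]big_seq.
  by apply: eq_bigr => q qs /=; rewrite rmorphXn /= aE // exprMn.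
have [k [j [S [T [B [C [[k0 j0 kj] ev a2 a4]]]]]]] := sum_sqr_quart_2adic a.
rewrite size_map in kj.
apply: (@no_2adic_solution (size s) k j S T B C d) => //; first by move: s15; lia.
(* If [d] and all numerators were even, half of [d] would be a smaller common denominator, against
   minimality. *)
- move=> kE; have [m [dE|dE]] := int_parity d; last by exists m.
  have := dmin (absz m); have mE : d%:R = 2 * (absz m)%:R :> rat.
    by rewrite -natrM; congr (_%:R); lia.
  have -> : (0 < `|m|)%N && all (fun q => (absz m)%:R * q \is a Num.int) s; last lia.
  apply/andP; split; first lia.
  apply/allP => q qs.
  have [c cE] := ev kE (Num.floor (d%:R * q)) (map_f _ qs).
  have := aE q qs; rewrite cE mE rmorphM /= -mulrA => /mulfI <- //.
- have := sumE 2%N; rewrite a2 => h.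
  apply: (@intr_inj rat); rewrite rmorphM /= h [RHS]rmorphM rmorphXn /=.
  by rewrite -!pmulrn -s2; ring.
- have := sumE 4%N; rewrite a4 => h.
  apply: (@intr_inj rat); rewrite rmorphM /= h [RHS]rmorphM rmorphXn rmorphM /=.
  by rewrite -!pmulrn -s4; ring.
Qed.

(** * Even moments of the Hermite measure *)

(** Follows from e^y >= y^(k+1) / (k+1)! at y = x^2, together with x <= x^(k+1). It makes the
    boundary terms of the integration by parts vanish in the limit. *)
Lemma exprn_gauss_fun_le (R : realType) (k : nat) (x : R) : 1 <= x ->
  x ^+ k.+1 * gauss_fun x <= k.+1`!%:R / x.
Proof.
move=> x1; have x0 : 0 < x by exact: lt_le_trans x1.
have fact0 : 0 < k.+1`!%:R :> R by rewrite ltr0n fact_gt0.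
have xk0 : 0 < x ^+ k.+1 by rewrite exprn_gt0.
have := @expR_ge1Dxn R (x ^+ 2) k (sqr_ge0 x).
rewrite /gauss_fun expRN => h.
have {}h : x ^+ k.+1 * x ^+ k.+1 / k.+1`!%:R <= expR (x ^+ 2).
  apply: le_trans h; rewrite -exprMn -expr2 -exprM mulnC exprM.
  by rewrite exprAC lerDr ler01.
rewrite ler_pdivlMr // mulrAC ler_pdivrMr ?expR_gt0 //.
rewrite ler_pdivrMr // in h.
rewrite [leRHS]mulrC; apply: le_trans h.
by rewrite ler_pM2l // exprS ler_peMr ?(ltW x0) // exprn_ege1.
Qed.

Lemma cvg_exprn_gauss_fun (R : realType) (k : nat) :
  n.+1%:R ^+ k.+1 * gauss_fun (n.+1%:R : R) @[n --> \oo] --> (0 : R).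
Proof.
apply: (@squeeze_cvgr _ _ _ _ (fun=> 0) (fun n => k.+1`!%:R * harmonic n)).
- apply: nearW => n; apply/andP; split.
    by rewrite mulr_ge0 ?exprn_ge0 ?gauss_fun_ge0.
  by apply: exprn_gauss_fun_le; rewrite ler1n.
- exact: cvg_cst.
- by rewrite -[X in _ --> X](mulr0 (k.+1`!%:R)); apply: cvgMr; exact: cvg_harmonic.
Qed.

Lemma is_derive_gauss_fun (R : realType) (x : R) :
  is_derive x 1 (@gauss_fun R) (- (2 * x * gauss_fun x)).
Proof.
rewrite /gauss_fun.
by apply: is_derive_eq; rewrite /GRing.scale /=; ring.
Qed.

Lemma continuous_exprn_gauss_fun (R : realType) (k : nat) :
  continuous (fun x : R => x ^+ k * gauss_fun x).
Proof.
by move=> x; apply: cvgM; [exact: exprn_continuous|exact: continuous_gauss_fun].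
Qed.

Lemma bigcup_itv_nat (R : realType) :
  \bigcup_n `[- n.+1%:R, n.+1%:R]%classic = [set: R].
Proof.
apply/seteqP; split => // x _; exists (Num.truncn `|x|) => //=.
by rewrite in_itv /= -ler_norml ltW // truncnS_gt.
Qed.

(** Integration by parts, splitting the integrand as x^(k+1) times x e^(-x^2); the latter has
    antiderivative -e^(-x^2)/2. *)
Lemma gauss_moment_rec_itv (R : realType) (k : nat) (b : R) : 0 < b -> ~~ odd k ->
  (\int[lebesgue_measure]_(x in `[(- b)%R, b]) (x ^+ k.+2 * gauss_fun x)%:E =
   (- (b ^+ k.+1 * gauss_fun b))%:E + (k.+1%:R / 2)%:E *
     \int[lebesgue_measure]_(x in `[(- b)%R, b]) (x ^+ k * gauss_fun x)%:E)%E.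
Proof.
move=> b0 evk.
pose F (x : R) : R := x ^+ k.+1.
pose G (x : R) : R := - 2^-1 * gauss_fun x.
have dF (x : R) : is_derive x 1 F (k.+1%:R * x ^+ k).
  have := is_deriveX k.+1 (is_derive_id x (1 : R)).
  by rewrite fctE /GRing.scale /= mulr1.
have dG (x : R) : is_derive x 1 G (x * gauss_fun x).
  have h := is_derive_gauss_fun x.
  by rewrite /G; apply: is_derive_eq; rewrite /GRing.scale /=; field.
have LR (f : R -> R) (f' : R -> R) : (forall x : R, is_derive x 1 f (f' x)) ->
    derivable_oo_LRcontinuous f (- b) b.
  move=> df; have cf (x : R) : {for x, continuous f}.
    by apply/differentiable_continuous/derivable1_diffP; case: (df x).
  split => [x _||]; [by case: (df x)|..].
  + by apply: cvg_at_right_filter; exact: cf.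
  + by apply: cvg_at_left_filter; exact: cf.
have := @integration_by_parts R F G (fun x => k.+1%:R * x ^+ k)
  (fun x => x * gauss_fun x) (- b) b.
have -> : (\int[lebesgue_measure]_(x in `[(- b)%R, b]) (F x * (x * gauss_fun x))%:E =
   \int[lebesgue_measure]_(x in `[(- b)%R, b]) (x ^+ k.+2 * gauss_fun x)%:E)%E.
  by apply: eq_integral => x _; congr (_%:E); rewrite /F [x ^+ k.+2]exprSr; ring.
move=> ->.
- congr (_ + _)%E.
    (* As k + 1 is odd, the boundary terms at b and -b add up, cancelling the factor 1/2. *)
    by congr (_%:E); rewrite /F /G /gauss_fun sqrrN exprNn -signr_odd /= evk expr1; field.
  have -> : (\int[lebesgue_measure]_(x in `[(- b)%R, b]) (k.+1%:R * x ^+ k * G x)%:E =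
     \int[lebesgue_measure]_(x in `[(- b)%R, b])
       ((- (k.+1%:R / 2))%:E * (x ^+ k * gauss_fun x)%:E))%E.
    by apply: eq_integral => x _; rewrite -EFinM; congr (_%:E); rewrite /G; field.
  rewrite integralZl //; first by rewrite EFinN mulNe oppeK.
  apply: continuous_compact_integrable; first exact: segment_compact.
  by apply: continuous_subspaceT; exact: continuous_exprn_gauss_fun.
- lra.
- apply: continuous_subspaceT => x; apply: cvgM; first exact: cvg_cst.
  exact: exprn_continuous.
- exact: LR dF.
- by move=> x _; rewrite derive1E; exact: derive_val.
- by apply: continuous_subspaceT; exact: (@continuous_exprn_gauss_fun R 1).
- exact: LR dG.
- by move=> x _; rewrite derive1E; exact: derive_val.
Qed.

(** Limit of the recursion on the intervals [-(n+1), n+1]. For even exponents the integrand is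
    nonnegative, so monotone convergence applies in the extended reals. *)
Lemma gauss_moment_rec (R : realType) (k : nat) : ~~ odd k ->
  (\int[@lebesgue_measure R]_x (x ^+ k.+2 * gauss_fun x)%:E =
   (k.+1%:R / 2)%:E * \int[@lebesgue_measure R]_x (x ^+ k * gauss_fun x)%:E)%E.
Proof.
move=> evk.
have cvgI m : ~~ odd m ->
    (\int[lebesgue_measure]_(x in `[(- n.+1%:R)%R, n.+1%:R]) (x ^+ m * gauss_fun x)%:E)%E
     @[n --> \oo] --> (\int[@lebesgue_measure R]_x (x ^+ m * gauss_fun x)%:E)%E.
  move=> evm; rewrite -(bigcup_itv_nat R).
  apply: ge0_nondecreasing_set_cvg_integral => //.
  - move=> p q pq; apply/subsetPset => x /=; rewrite !in_itv /= -!ler_norml.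
    by move=> /le_trans; apply; rewrite ler_nat ltnS.
  - move=> n; apply/measurable_EFinP/measurable_funTS.
    by apply: continuous_measurable_fun; exact: continuous_exprn_gauss_fun.
  - by move=> n x _; rewrite lee_fin mulr_ge0 ?gauss_fun_ge0 // exprn_even_ge0.
rewrite -[RHS]add0e; apply: (cvg_unique _ (cvgI k.+2 _)) => //; first by rewrite /= negbK.
rewrite /mkset (eq_cvg _ _ (fun n => gauss_moment_rec_itv (ltr0Sn R n) evk)).
apply: cvgeD => //.
- apply/fine_cvgP; split; first exact: nearW.
  by rewrite /comp /= -oppr0; apply: cvgN; exact: cvg_exprn_gauss_fun.
- by apply: cvgeZl => //; exact: cvgI.
Qed.

Lemma hermite_moment (R : realType) (k : nat) (c : R) : ~~ odd k ->
  (\int[@lebesgue_measure R]_x (x ^+ k * gauss_fun x)%:E = (c * Num.sqrt pi)%:E)%E ->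
  (\int[@lebesgue_measure R]_x (('X^k : {poly R}).[x] * hermite_weight x)%:E = c%:E)%E.
Proof.
move=> evk hk.
under eq_integral => x _ do
  rewrite hornerXn /hermite_weight mulrA mulrC EFinM.
have sp : 0 < Num.sqrt (pi : R) by rewrite sqrtr_gt0 pi_gt0.
rewrite ge0_integralZl //.
- by rewrite hk -EFinM; congr (_%:E); rewrite mulrC mulfK // gt_eqF.
- apply/measurable_EFinP.
  by apply: continuous_measurable_fun; exact: continuous_exprn_gauss_fun.
- by move=> x _; rewrite lee_fin mulr_ge0 ?gauss_fun_ge0 // exprn_even_ge0.
Qed.

Lemma gauss_moment0 (R : realType) :
  (\int[@lebesgue_measure R]_x (x ^+ 0 * gauss_fun x)%:E = (Num.sqrt pi)%:E)%E.
Proof. by under eq_integral do rewrite expr0 mul1r; exact: integralT_gauss. Qed.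

Lemma hermite_moment2 (R : realType) :
  (\int[@lebesgue_measure R]_x (('X^2 : {poly R}).[x] * hermite_weight x)%:E = (2^-1)%:E)%E.
Proof.
by apply: hermite_moment => //; rewrite gauss_moment_rec // gauss_moment0 div1r.
Qed.

Lemma hermite_moment4 (R : realType) :
  (\int[@lebesgue_measure R]_x (('X^4 : {poly R}).[x] * hermite_weight x)%:E = (3 / 4)%:E)%E.
Proof.
apply: hermite_moment => //; rewrite !gauss_moment_rec // gauss_moment0 -!EFinM.
by congr (_%:E); field.
Qed.

(** * Antipodal point sets and the conclusion *)

Lemma antipodal_perm_pos (R : realType) (n : nat) (x : n.-tuple R) : uniq x ->
  antipodal x -> ~~ odd n ->
  perm_eq x ([seq a <- x | 0 < a] ++ [seq - a | a <- [seq a <- x | 0 < a]]).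
Proof.
move=> ux ax evn; set s := seq.filter _ _.
have memN a : (- a \in x) = (a \in x).
  by rewrite (ax (- a)) mem_map //; exact: oppr_inj.
have us : uniq (s ++ [seq - a | a <- s]).
  rewrite cat_uniq map_inj_uniq ?filter_uniq //=.
  rewrite andbT; apply/hasPn => _ /mapP[a + ->]; rewrite !mem_filter => /andP[a0 _].
  by rewrite oppr_gt0 ltNge (ltW a0).
have memE a : (a \in s ++ [seq - a | a <- s]) = (a != 0) && (a \in x).
  rewrite mem_cat -[a in X in _ || X]opprK mem_map; last exact: oppr_inj.
  rewrite !mem_filter memN oppr_gt0 -andb_orl.
  by rewrite neq_lt orbC.
suff x0 : 0 \notin x.
  apply: uniq_perm => // a; rewrite memE; case: eqVneq => [->|//].
  by rewrite (negbTE x0).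
(* Zero is its own antipode, so its presence would make the number of points odd. *)
apply/negP => x0; move: evn; rewrite -(size_tuple x).
suff /perm_size -> : perm_eq x (0 :: (s ++ [seq - a | a <- s])).
  by rewrite /= size_cat size_map addnn odd_double.
apply: uniq_perm => //=; first by rewrite us memE eqxx.
by move=> a; rewrite inE memE; case: eqVneq => [->|].
Qed.

Theorem theorem8p4 (R : realType) (N : nat) (hN : (1 <= N <= 15)%N)
    (hN14 : N <> 14%N) :
  ~ exists x : (2 * N).-tuple R,
      [/\ is_design (`]-oo, +oo[ : interval R) (@hermite_weight R) 5 x,
          rational_points x & antipodal x].
Proof.
case=> x [[ux _ quad] ratx antix].
have N0 : N%:R != 0 :> R by rewrite pnatr_eq0; case: N hN {hN14 x ux quad ratx antix}.
have ev2N : ~~ odd (2 * N) by rewrite mul2n odd_double.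
pose s := [seq a <- x | 0 < a].
have ps : perm_eq x (s ++ [seq - a | a <- s]) by exact: antipodal_perm_pos.
have size_s : size s = N.
  have := perm_size ps; rewrite size_tuple size_cat size_map addnn -mul2n.
  by move/eqP; rewrite eqn_mul2l => /eqP.
(* An even power takes equal values at a and -a, so the sum over all 2N points is twice the sum over
   [s], and the averaging factor 1/(2N) becomes 1/N. *)
have sum_s k (c : R) : ~~ odd k -> (k <= 5)%N ->
    (\int[@lebesgue_measure R]_t (('X^k : {poly R}).[t] * hermite_weight t)%:E = c%:E)%E ->
    \sum_(a <- s) a ^+ k = N%:R * c.
  move=> evk k5 momk.
  have := quad 'X^k; rewrite size_polyXn ltnS set_itvNyy => /(_ k5).
  rewrite momk => -[]; under eq_bigr do rewrite hornerXn.
  rewrite (perm_big _ ps) /= big_cat /= big_map.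
  under [X in _ + X]eq_bigr => a _ do rewrite exprNn -signr_odd (negbTE evk) mul1r.
  by rewrite natrM => <-; field.
(* The positive points are lifted to a list over [rat], where denominators are available;
   injectivity of [ratr] carries the power sums back. *)
have [q sE] : exists q : seq rat, s = [seq ratr a | a <- q].
  have : {in s, forall a, exists r : rat, a = ratr r}.
    by move=> a; rewrite mem_filter => /andP[_ /ratx].
  elim: {size_s sum_s ps} s => [|a s IH] rats; first by exists [::].
  have [r ->] := rats a (mem_head _ _).
  have [|q ->] := IH; first by move=> b bs; apply: rats; rewrite inE bs orbT.
  by exists (r :: q).
have size_q : size q = N by rewrite -size_s sE size_map.
have sumE k : ratr (\sum_(a <- q) a ^+ k) = \sum_(a <- s) a ^+ k :> R.
  by rewrite sE big_map rmorph_sum; apply: eq_bigr => a _; rewrite rmorphXn.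
apply: (@no_rational_power_sums q); rewrite ?size_q //; apply: (fmorph_inj (@ratr R)).
- rewrite rmorphM /= !ratr_nat sumE (sum_s _ _ _ _ (hermite_moment2 R)) //.
  by field.
- rewrite !rmorphM /= !ratr_nat sumE (sum_s _ _ _ _ (hermite_moment4 R)) //.
  by field.
Qed.
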